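(* Let $G$ be a simple graph with vertex set $[n]=\{1,\dots,n\}$ and without isolated vertices, and let $P=\{i,j\}$ be an edge of $G$. Then $$\gamma_{2,P}=n-\max\bigl\{|A|-|N_G(A)| \;\bigm|\; A\text{ is a }P\text{-admissible independent set of }G\bigr\}.$$
   Context: A vector $\mathbf a\in\mathbb N^n$ ($\mathbb N$ includes $0$) is a $2$-cover of $G$ if $a_u+a_v\ge 2$ for every edge $\{u,v\}\in E(G)$; it is $P$-tight, for the edge $P=\{i,j\}$, if moreover $a_i+a_j=2$. Write $|\mathbf b|=b_1+\dots+b_n$. Then $\gamma_{2,P}=\min\{|\mathbf b| \mid \mathbf b\text{ is a }P\text{-tight }2\text{-cover of }G\}$. For $A\subseteq V(G)$, $N_G(A)=\bigcup_{u\in A}N_G(u)$, where $N_G(u)$ is the set of neighbors of $u$. An independent set $A$ of $G$ (possibly empty) is called $P$-admissible if either $i\in A$ or $j\in A$, or $\{i,j\}\cap(A\cup N_G(A))=\emptyset$. *)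

(* Defs.v *)
From mathcomp Require Import all_boot all_order all_algebra.
From mathcomp Require Import boolp.

Set Implicit Arguments.
Unset Strict Implicit.
Unset Printing Implicit Defensive.

Import Order.TTheory GRing.Theory Num.Theory.

Local Open Scope ring_scope.

Section Graph.
Variables (n : nat) (e : rel 'I_n).

Definition simple_graph : Prop := symmetric e /\ irreflexive e.

Definition no_isolated_vertex : Prop := forall u, exists v, e u v.

Definition cover2 (a : {ffun 'I_n -> nat}) : bool :=
  [forall u, forall v, e u v ==> (2 <= a u + a v)%N].

Definition tight_cover2 (i j : 'I_n) (a : {ffun 'I_n -> nat}) : bool :=
  cover2 a && (a i + a j == 2)%N.

Definition weight (b : {ffun 'I_n -> nat}) : nat := (\sum_u b u)%N.

Definition tight_weight (i j : 'I_n) (k : nat) : Prop :=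
  exists2 b, tight_cover2 i j b & weight b = k.

Lemma tight_weight_ex (i j : 'I_n) : exists k, `[< tight_weight i j k >].
Proof.
exists (weight [ffun=> 1%N]); apply/asboolP; exists [ffun=> 1%N] => //.
apply/andP; split; last by rewrite !ffunE.
by apply/forallP=> u; apply/forallP=> v; rewrite !ffunE implybT.
Qed.

Definition gamma2 (i j : 'I_n) : nat := ex_minn (tight_weight_ex i j).

Definition neighbors (u : 'I_n) : {set 'I_n} := [set v | e u v].

Definition neighborhood (A : {set 'I_n}) : {set 'I_n} :=
  \bigcup_(u in A) neighbors u.

Definition independent (A : {set 'I_n}) : bool :=
  [forall u in A, forall v in A, ~~ e u v].

Definition admissible (i j : 'I_n) (A : {set 'I_n}) : bool :=
  independent A &&
  [|| i \in A, j \in A | [set i; j] :&: (A :|: neighborhood A) == set0].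

Definition excess (A : {set 'I_n}) : int := #|A|%:Z - #|neighborhood A|%:Z.

(* The maximum is over a nonempty family, since the empty set is admissible;
   [max_excessP] below checks that it is the greatest attained value. *)
Definition max_excess (i j : 'I_n) : int :=
  excess [arg max_(A > set0 | admissible i j A) excess A]%O.

Lemma gamma2P (i j : 'I_n) :
  tight_weight i j (gamma2 i j) /\
  forall b, tight_cover2 i j b -> (gamma2 i j <= weight b)%N.
Proof.
rewrite /gamma2; case: ex_minnP => m /asboolP tm min_m; split=> // b tb.
by apply: min_m; apply/asboolP; exists b.
Qed.

Lemma admissible0 (i j : 'I_n) : admissible i j set0.
Proof.
apply/andP; split; first by apply/forall_inP=> u; rewrite inE.
by rewrite /neighborhood big_set0 setU0 setI0 eqxx !orbT.
Qed.

Lemma max_excessP (i j : 'I_n) :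
  (exists2 A, admissible i j A & excess A = max_excess i j) /\
  forall A, admissible i j A -> excess A <= max_excess i j.
Proof.
rewrite /max_excess; case: arg_maxP => [|A adA maxA]; first exact: admissible0.
by split=> //; exists A.
Qed.

End Graph.

(* Main.v *)
(** Let [A] be the zero set of a tight 2-cover [b].  Then [A] is admissible,
    [b >= 2] on [N(A)] and [b >= 1] on the rest, so [b] dominates the function
    equal to [0] on [A], [2] on [N(A)] and [1] elsewhere.  Conversely that
    function is a tight 2-cover for every admissible [A], and its weight is
    [n - (|A| - |N(A)|)]. *)
Require Import Defs.
From mathcomp Require Import all_boot all_order all_algebra.
From mathcomp Require Import zify.

Local Open Scope ring_scope.

Import Order.TTheory GRing.Theory Num.Theory.

Definition cover_of_set {n : nat} (e : rel 'I_n) (A : {set 'I_n}) :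
    {ffun 'I_n -> nat} :=
  [ffun u => (if u \in A then 0 else if u \in neighborhood e A then 2 else 1)%N].

Definition zero_set {n : nat} (b : {ffun 'I_n -> nat}) : {set 'I_n} :=
  [set u | b u == 0%N].

Lemma neighborhoodP {n : nat} (e : rel 'I_n) (A : {set 'I_n}) (v : 'I_n) :
  reflect (exists2 u, u \in A & e u v) (v \in neighborhood e A).
Proof.
by apply: (iffP bigcupP) => -[u uA]; rewrite ?inE => euv; exists u; rewrite ?inE.
Qed.

Lemma independent_notin_neighborhood {n : nat} {e : rel 'I_n}
    {A : {set 'I_n}} {u : 'I_n} :
  independent e A -> u \in A -> u \notin neighborhood e A.
Proof.
move=> /forall_inP indA uA; apply/neighborhoodP => -[v vA].
by apply/negP; move/forall_inP: (indA _ vA); apply.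
Qed.

(** Independence makes [A] and its neighborhood disjoint, so at each vertex the value plus the
    indicator of [A] equals 1 plus the indicator of the neighborhood; sum over all vertices. *)
Lemma weight_cover_of_set {n : nat} {e : rel 'I_n} {A : {set 'I_n}} :
  independent e A -> (weight (cover_of_set e A))%:Z = n%:Z - excess e A.
Proof.
move=> indA.
(* Without subtraction, the identity lives in [nat] and can be checked vertex by vertex. *)
suff : (weight (cover_of_set e A) + #|A| = n + #|neighborhood e A|)%N.
  by rewrite /excess; lia.
have cardE (B : {set 'I_n}) : #|B| = (\sum_u (u \in B))%N.
  by rewrite -sum1_card big_mkcond; apply: eq_bigr => u _; case: ifP.
have sum1n : (\sum_(u < n) 1 = n)%N by rewrite sum1_card card_ord.
rewrite /weight !cardE -[X in _ = (X + _)%N]sum1n -!big_split.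
apply: eq_bigr => u _; rewrite ffunE /=.
have [uA|//] := boolP (u \in A).
  by rewrite (negPf (independent_notin_neighborhood indA uA)).
by case: ifP.
Qed.

(** Independence keeps [v] out of [A], so the value 0 is excluded. *)
Lemma cover_of_set_neighbor {n : nat} {e : rel 'I_n} {A : {set 'I_n}}
    {u v : 'I_n} :
  independent e A -> e u v -> u \in A -> cover_of_set e A v = 2%N.
Proof.
move=> indA euv uA.
have vN : v \in neighborhood e A by apply/neighborhoodP; exists u.
rewrite ffunE vN; case: ifP => // /(independent_notin_neighborhood indA).
by rewrite vN.
Qed.

Lemma cover2_cover_of_set {n : nat} {e : rel 'I_n} {A : {set 'I_n}} :
  symmetric e -> independent e A -> cover2 e (cover_of_set e A).
Proof.
move=> symE indA; apply/forallP=> u; apply/forallP=> v; apply/implyP=> euv.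
have evu : e v u by rewrite symE.
have [uA|uA] := boolP (u \in A).
  by rewrite (cover_of_set_neighbor indA euv uA) leq_addl.
have [vA|vA] := boolP (v \in A).
  by rewrite (cover_of_set_neighbor indA evu vA) leq_addr.
by rewrite !ffunE (negPf uA) (negPf vA); do 2 case: ifP.
Qed.

(** On the edge [{i, j}] the values are 0 and 2 if an endpoint lies in [A]; otherwise admissibility
    makes both equal to 1. *)
Lemma tight_cover2_cover_of_set {n : nat} {e : rel 'I_n} {i j : 'I_n}
    {A : {set 'I_n}} :
  symmetric e -> e i j -> admissible e i j A ->
  tight_cover2 e i j (cover_of_set e A).
Proof.
move=> symE eij /andP[indA admA]; apply/andP; split.
  exact: cover2_cover_of_set.
have eji : e j i by rewrite symE.
case/or3P: admA => [iA|jA|/eqP disj].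
- by rewrite (cover_of_set_neighbor indA eij iA) ffunE iA.
- by rewrite (cover_of_set_neighbor indA eji jA) ffunE jA.
rewrite !ffunE.
(* Reading [set0] as the intersection in [disj] puts [i] and [j] outside [A] and its
   neighborhood. *)
have := in_set0 i; have := in_set0 j; rewrite -disj !inE !eqxx orbT /=.
by do 2 move=> /norP[/negPf-> /negPf->].
Qed.

Lemma cover2_ge2_neighborhood {n : nat} {e : rel 'I_n}
    {b : {ffun 'I_n -> nat}} {v : 'I_n} :
  cover2 e b -> v \in neighborhood e (zero_set b) -> (2 <= b v)%N.
Proof.
move=> /forallP cov /neighborhoodP[u]; rewrite inE => /eqP bu0 euv.
by have /forallP/(_ v) := cov u; rewrite euv bu0.
Qed.

Lemma independent_zero_set {n : nat} {e : rel 'I_n} {b : {ffun 'I_n -> nat}} :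
  cover2 e b -> independent e (zero_set b).
Proof.
move=> /forallP cov; apply/forall_inP=> u; rewrite inE => /eqP bu0.
apply/forall_inP=> v; rewrite inE => /eqP bv0.
by have /forallP/(_ v) := cov u; rewrite bu0 bv0 implybF.
Qed.

(** If [b] vanishes at neither endpoint, tightness forces the value 1 at both, whereas neighbors of
    zeros have value at least 2. *)
Lemma admissible_zero_set {n : nat} {e : rel 'I_n} {i j : 'I_n}
    {b : {ffun 'I_n -> nat}} :
  tight_cover2 e i j b -> admissible e i j (zero_set b).
Proof.
move=> /andP[cov /eqP bij]; rewrite /admissible independent_zero_set //= !inE.
have [//|bi0] := eqVneq (b i) 0%N; have [//|bj0 /=] := eqVneq (b j) 0%N.
apply/eqP/setP=> u; rewrite in_set0; apply/negP; rewrite in_setI in_set2 in_setU.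
move=> /andP[uij uAN]; have bu1 : b u = 1%N by case/orP: uij => /eqP->; lia.
case/orP: uAN => [|/(cover2_ge2_neighborhood cov)]; last by rewrite bu1.
by rewrite inE bu1.
Qed.

Lemma weight_cover_of_zero_set {n : nat} {e : rel 'I_n}
    {b : {ffun 'I_n -> nat}} :
  cover2 e b -> (weight (cover_of_set e (zero_set b)) <= weight b)%N.
Proof.
move=> cov; apply: leq_sum => u _; rewrite ffunE; case: ifP => //.
rewrite inE => bu0; case: ifP => [|_]; last by rewrite lt0n bu0.
exact: cover2_ge2_neighborhood.
Qed.

Theorem lemma2p12 (n : nat) (e : rel 'I_n) (i j : 'I_n)
    (He : simple_graph e) (Hiso : no_isolated_vertex e) (Hij : e i j) :
  (gamma2 e i j)%:Z = n%:Z - max_excess e i j.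
Proof.
case: He => symE _.
have [[b tb <-] gamma_le] := gamma2P e i j.
have [[A adA <-] le_max] := max_excessP e i j.
have [covb _] := andP tb; have [indA _] := andP adA.
(* With [b] and [A] optimal, this gives one inequality; the zero set of [b], compared with [A],
   gives the other. *)
have := gamma_le _ (tight_cover2_cover_of_set symE Hij adA).
have := weight_cover_of_set indA.
have := le_max _ (admissible_zero_set tb).
have := weight_cover_of_set (independent_zero_set covb).
have := weight_cover_of_zero_set covb.
lia.
Qed.
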